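(* Let $p\in(0,1)$. The TBF $\mu'_p$ is consistent with a translation-invariant left interval-specification $\rho_p$ on $(\Omega',\mathscr F')$ whose single-site kernel at the origin depends only on $\omega'_0$ and on $n(\omega')$, namely $$\rho_{p,\{0\}}(\sigma_0=0\mid\omega')=g_p(n(\omega')),\qquad \rho_{p,\{0\}}(\sigma_0=1\mid\omega')=1-g_p(n(\omega')),$$ where $g_p(0)=0$, $g_p(1)=1-p$, and for $n\in\{2,3,\dots\}$ $$g_p(n)=\frac{(-1)^{n+1}|a|^n\frac{\lambda_{PF}}{1-\lambda_r}+\frac{\lambda_{PF}}{1-\lambda_{PF}}}{(-1)^n|a|^{n-1}\frac{1}{1-\lambda_r}+\frac{1}{1-\lambda_{PF}}},$$ and $g_p(\infty)=\lambda_{PF}$ (the value of the same formula with $|a|^\infty:=0$).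
   Context: Fix $p\in(0,1)$. Let $\Omega=\{0,1\}^{\mathbb{Z}}$ with product $\sigma$-algebra $\mathscr F$, $\mu_p=\mathrm{Ber}(p)^{\otimes\mathbb{Z}}$, $T:\Omega\to\Omega$, $(T\omega)_i=\omega_i\big(1-(1-\omega_{i-1})(1-\omega_{i+1})\big)$, $\Omega'=T(\Omega)$ (configurations in which every occupied site has an occupied neighbour), $\mathscr F'=\mathscr F\cap\Omega'$, and the TBF $\mu'_p=\mu_p\circ T^{-1}$. $\sigma_i$ denotes the spin at site $i$. Let $\lambda_{PF}=\tfrac12\big(1-p+\sqrt{(1-p)(3p+1)}\big)\in(0,1)$, $\lambda_r=\tfrac12\big(1-p-\sqrt{(1-p)(3p+1)}\big)\in(-\tfrac13,0)$ (the eigenvalues of the matrix $\begin{pmatrix}1-p&\sqrt{p(1-p)}\\ \sqrt{p(1-p)}&0\end{pmatrix}$), and $a=\lambda_r/\lambda_{PF}\in(-1,0)$. For $\omega'\in\Omega'$ let $n(\omega')=\min\{i\in\mathbb N:(\omega'_{-i-1},\omega'_{-i})=(1,1)\}$ (distance to the nearest pair of adjacent occupied sites in the past), with the conventions $n(\omega')=0$ if $(\omega'_{-2},\omega'_{-1})=(0,1)$ and $n(\omega')=\infty$ if no such pair exists. Left interval-specification (LIS): let $\mathcal S_b$ be the set of finite integer intervals; for $\Lambda\in\mathcal S_b$ write $l_\Lambda=\min\Lambda$, $m_\Lambda=\max\Lambda$, $\mathscr F_{\le x}$, $\mathscr F_{<x}$ for the $\sigma$-algebras generated by spins in $(-\infty,x]$,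 $(-\infty,x)$. A LIS is a family $(\rho_\Lambda)_{\Lambda\in\mathcal S_b}$ of probability kernels $\rho_\Lambda:\mathscr F_{\le m_\Lambda}\times\Omega'\to[0,1]$ such that $\rho_\Lambda(A\mid\cdot)$ is $\mathscr F_{<l_\Lambda}$-measurable, $\rho_\Lambda(B\mid\omega)=\mathbb 1_B(\omega)$ for $B\in\mathscr F_{<l_\Lambda}$, and $\rho_\Delta\rho_\Lambda f=\rho_\Delta f$ for $\Lambda\subset\Delta$ and $\mathscr F_{\le m_\Lambda}$-measurable $f$. A probability measure $\mu$ is consistent with $\rho$ if $\mu\rho_\Lambda(f)=\mu(f)$ for all $\Lambda\in\mathcal S_b$ and all $\mathscr F_{\le m_\Lambda}$-measurable $f$. A LIS is determined by its single-site kernels; translation invariance means $\rho_{\{i\}}$ is the shift of $\rho_{\{0\}}$. *)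

(* Defs.v *)
From HB Require Import structures.
From mathcomp Require Import all_boot all_order all_algebra.
From mathcomp Require Import all_classical all_reals all_analysis.
From mathcomp Require Import measurable_realfun.
Set Implicit Arguments. Unset Strict Implicit. Unset Printing Implicit Defensive.
Import Order.TTheory GRing.Theory Num.Theory.
Local Open Scope classical_set_scope.
Local Open Scope ring_scope.

(* Omega = {0,1}^Z : configurations, true = occupied (spin 1). *)
Definition config := int -> bool.

Definition spin_events_config : set (set config) :=
  [set A | exists (i : int) (b : bool), A = [set w | w i = b]].

Definition Omega := g_sigma_algebraType spin_events_config.

Definition OmegaP_pred (w : config) : Prop :=
  forall i : int, w i -> w (i - 1) || w (i + 1).

Definition OmegaP := {w : config | OmegaP_pred w}.

Lemma OmegaP_pred0 : OmegaP_pred (fun _ => false).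
Proof. by []. Qed.

HB.instance Definition _ := gen_eqMixin OmegaP.
HB.instance Definition _ := gen_choiceMixin OmegaP.
HB.instance Definition _ :=
  isPointed.Build OmegaP (exist _ (fun _ => false) OmegaP_pred0).

Definition spin (i : int) (w : OmegaP) : bool := sval w i.

(* F_{<= x} on Omega' : generated by the spins at sites j <= x
   (this is the trace on Omega' of the corresponding sigma-algebra on Omega). *)
Definition spin_events_le (x : int) : set (set OmegaP) :=
  [set A | exists (j : int) (b : bool), j <= x /\ A = [set w | spin j w = b]].

(* (Omega', F'_{<= x}) as a measurable type; F_{< x} = F_{<= x - 1}. *)
Definition OmegaLe (x : int) := g_sigma_algebraType (spin_events_le x).

Definition spin_events_all : set (set OmegaP) :=
  [set A | exists (j : int) (b : bool), A = [set w | spin j w = b]].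
Definition OmegaPF := g_sigma_algebraType spin_events_all.

Definition Tmap_config (w : config) : config :=
  fun i => w i && (w (i - 1) || w (i + 1)).

Lemma Tmap_config_OmegaP (w : config) : OmegaP_pred (Tmap_config w).
Proof.
move=> i; rewrite /Tmap_config => /andP[wi /orP[wl|wr]].
- apply/orP; left; rewrite wl /= addrNK wi; by rewrite orbT.
- apply/orP; right; rewrite wr /= addrK wi; by [].
Qed.

Definition Tmap (w : config) : OmegaP := exist _ (Tmap_config w) (@Tmap_config_OmegaP w).

Lemma shift_OmegaP (k : int) (w : OmegaP) : OmegaP_pred (fun j => sval w (j + k)).
Proof.
move=> i /= h; have := svalP w (i + k) h.
by rewrite addrAC (addrAC i 1 k).
Qed.

Definition shift (k : int) (w : OmegaP) : OmegaP :=
  exist _ (fun j => sval w (j + k)) (@shift_OmegaP k w).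

Definition pairAt (w : OmegaP) (i : nat) : bool :=
  [&& (0 < i)%N, spin (- (i%:Z) - 1) w & spin (- (i%:Z)) w].

(* n(w'): Some k for k in N, None for infinity *)
Definition n_of (w : OmegaP) : option nat :=
  if spin (-1) w && ~~ spin (-2) w then Some 0%N
  else match pselect (exists i, pairAt w i) with
       | left h => Some (ex_minn h)
       | right _ => None
       end.

Section Constants.
Variable R : realType.
Variable p : R.

Definition lamPF : R := (1 - p + Num.sqrt ((1 - p) * (3 * p + 1))) / 2.
Definition lamR : R := (1 - p - Num.sqrt ((1 - p) * (3 * p + 1))) / 2.
Definition aconst : R := lamR / lamPF.

Definition g_p (n : option nat) : R :=
  match n with
  | None => lamPF
  | Some 0%N => 0
  | Some 1%N => 1 - p
  | Some n => ((-1) ^+ n.+1 * `|aconst| ^+ n * (lamPF / (1 - lamR))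
                 + lamPF / (1 - lamPF))
              / ((-1) ^+ n * `|aconst| ^+ n.-1 * (1 / (1 - lamR))
                 + 1 / (1 - lamPF))
  end.
End Constants.

(* A family of kernels indexed by intervals [l, m] (l <= m):
   rho l m w is a probability measure on (Omega', F_{<= m}). *)
Definition kernel_family (R : realType) :=
  forall (l m : int), OmegaP -> probability (OmegaLe m) R.

Section LIS.
Variable R : realType.
Variable rho : kernel_family R.

Definition is_LIS : Prop :=
  (forall (l m : int), l <= m ->
     forall A : set (OmegaLe m), measurable A ->
       measurable_fun (setT : set (OmegaLe (l - 1))) (fun w => rho l m w A))
  /\
  (forall (l m : int), l <= m ->
     forall B : set (OmegaLe (l - 1)), measurable B ->
       forall w : OmegaP, rho l m w B = (\1_B w)%:E)
  /\
  (forall (lL mL lD mD : int), lL <= mL -> lD <= lL -> mL <= mD ->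
     forall f : OmegaLe mL -> \bar R, measurable_fun setT f -> (forall x, 0 <= f x)%E ->
       forall w : OmegaP,
         (\int[rho lD mD w]_x (\int[rho lL mL x]_y f y) = \int[rho lD mD w]_x f x)%E).

Definition LIS_translation_invariant : Prop :=
  forall (i : int) (w : OmegaP) (A : set (OmegaLe i)), measurable A ->
    rho i i w A = rho 0 0 (shift i w) (shift (- i) @^-1` A).

(* consistency of the TBF mu' = mu o T^{-1} with rho, where mu is a
   probability measure on (Omega, F); integrals against mu' are written as
   integrals against mu of the composition with T. *)
Definition TBF_consistent_with (mu : probability Omega R) : Prop :=
  forall (l m : int), l <= m ->
    forall f : OmegaLe m -> \bar R, measurable_fun setT f -> (forall x, 0 <= f x)%E ->
      (\int[mu]_w (\int[rho l m (Tmap w)]_y f y) = \int[mu]_w f (Tmap w))%E.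
End LIS.

(* mu is the Bernoulli(p) product measure on (Omega, F): its values on
   finite-dimensional cylinders (this determines mu uniquely). *)
Definition is_bernoulli_product (R : realType) (p : R) (mu : probability Omega R) : Prop :=
  forall (s : seq int) (v : int -> bool), uniq s ->
    mu [set w : Omega | forall i, i \in s -> w i = v i]
    = (\prod_(i <- s) (if v i then p else 1 - p))%:E.

(* Main.v *)
Require Import Defs.
From HB Require Import structures.
From mathcomp Require Import all_boot all_order all_algebra.
From mathcomp Require Import all_classical all_reals all_analysis.
From mathcomp Require Import measurable_realfun.
From mathcomp Require Import ring lra zify.
Import Order.TTheory GRing.Theory Num.Theory.
(* Reimported so that [shift] is the one on configurations. *)
Import Defs.
Local Open Scope classical_set_scope.
Local Open Scope ring_scope.
Set Implicit Arguments.
Unset Strict Implicit.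
Unset Printing Implicit Defensive.

(** A maximal-run argument on the original Bernoulli field.  If the last
    occupied pair of the thinned past ends at distance n, then the thinned past
    up to that pair is a function of the Bernoulli spins up to the pair, while
    the n - 1 zeros seen afterwards only say that the next spin is 0 and that
    the following n - 1 independent spins contain no two adjacent ones.  Hence
    the conditional probability of a further zero is q_n / q_(n-1), where q_m
    is the probability that m independent Bernoulli(p) bits contain no two
    adjacent ones; q_m solves a linear recursion with characteristic roots
    lamPF and lamR, and its closed form yields g_p.  An infinite distance has
    probability zero.  The kernels are finite mixtures of Dirac masses obtained
    by filling the sites of the interval from left to right. *)

(** * Words without two consecutive ones *)

Section RunFree.
Variables (R : realType) (p : R).
Hypotheses (p_gt0 : 0 < p) (p_lt1 : p < 1).

(* Probability that [m] independent Bernoulli(p) bits show no two adjacent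
   ones; the recursion conditions on the first one or two bits. *)
Fixpoint runfree (m : nat) : R :=
  match m with
  | 0%N => 1
  | m1.+1 => match m1 with
             | 0%N => 1
             | m2.+1 => (1 - p) * runfree m1 + p * (1 - p) * runfree m2
             end
  end.

Lemma runfreeSS m :
  runfree m.+2 = (1 - p) * runfree m.+1 + p * (1 - p) * runfree m.
Proof. by []. Qed.

Lemma runfree_gt0 m : 0 < runfree m.
Proof.
suff [] : 0 < runfree m /\ 0 < runfree m.+1 by [].
elim: m => [|m [h0 h1]]; first by rewrite /= ltr01.
split=> //; rewrite runfreeSS addr_gt0 ?mulr_gt0 ?subr_gt0 //.
Qed.

Lemma runfree_le m : runfree m.+1 <= runfree m.
Proof.
case: m => [//|m]; rewrite runfreeSS.
(* By the recursion, [runfree m.+2 - runfree m.+1] is [p] times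
   [(1 - p) * runfree m - runfree m.+1]. *)
suff : (1 - p) * runfree m <= runfree m.+1 by have := p_gt0; nra.
case: m => [|m]; first by rewrite /= mulr1 gerBl ltW.
by rewrite runfreeSS lerDl !mulr_ge0 ?subr_ge0 ?ltW // runfree_gt0.
Qed.

(** By monotonicity, two steps of the recursion cost a factor of at most (1 - p) + p (1 - p) = 1 -
    p^2. The geometric decay makes an infinite distance a null event. *)
Lemma runfree_le_expr m : runfree (m.*2) <= (1 - p ^+ 2) ^+ m.
Proof.
elim: m => [//|m IH]; rewrite doubleS runfreeSS exprS.
have h := runfree_le m.*2; have h0 := runfree_gt0 m.*2.
apply: (@le_trans _ _ ((1 - p ^+ 2) * runfree m.*2)).
  have : 0 < 1 - p by rewrite subr_gt0.
  move=> ?; nra.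
by rewrite ler_wpM2l // subr_ge0 exprn_ile1 // ltW.
Qed.

(** * The eigenvalues and the closed form of [runfree] *)

Let D := (1 - p) * (3 * p + 1).

Let sqrD : Num.sqrt D ^+ 2 = D.
Proof. by rewrite sqr_sqrtr // /D mulr_ge0 //; have := p_gt0; have := p_lt1; lra. Qed.

(** Compare squares. The lower bound makes [lamR] negative, the upper one keeps [lamPF] below 1. *)
Let sqrt_bounds : 1 - p < Num.sqrt D < 1 + p.
Proof.
have s0 : 0 <= Num.sqrt D by rewrite sqrtr_ge0.
by apply/andP; split; rewrite -(ltr_pXn2r (n := 2)) ?nnegrE ?sqrD /D //;
  have := p_gt0; have := p_lt1; nra.
Qed.

Lemma lamPF_gt0 : 0 < lamPF p.
Proof.
by rewrite /lamPF -/D divr_gt0 //; case/andP: sqrt_bounds; have := p_lt1; lra.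
Qed.

Lemma lamPF_lt1 : lamPF p < 1.
Proof. by rewrite /lamPF -/D ltr_pdivrMr //; case/andP: sqrt_bounds; lra. Qed.

Lemma lamR_lt0 : lamR p < 0.
Proof. by rewrite /lamR -/D; case/andP: sqrt_bounds; lra. Qed.

Lemma lamPF_root : lamPF p ^+ 2 = (1 - p) * lamPF p + p * (1 - p).
Proof.
have : Num.sqrt D ^+ 2 = D by exact: sqrD.
by rewrite /lamPF -/D => h; rewrite expr_div_n sqrrD h /D; field.
Qed.

Lemma lamR_root : lamR p ^+ 2 = (1 - p) * lamR p + p * (1 - p).
Proof.
have : Num.sqrt D ^+ 2 = D by exact: sqrD.
by rewrite /lamR -/D => h; rewrite expr_div_n sqrrB h /D; field.
Qed.

Let L := lamPF p.
Let r := lamR p.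

(** Both sides solve the same second-order recursion. They agree at 0 by the choice of the constant,
    and at 1 because L / (1 - L) = 1 / (1 - L) - 1, and likewise for r. *)
Lemma runfree_closed_form m :
  runfree m * ((1 - L)^-1 - (1 - r)^-1) = L ^+ m / (1 - L) - r ^+ m / (1 - r).
Proof.
have nL : 1 - L != 0 by rewrite subr_eq0 gt_eqF // lamPF_lt1.
have nr : 1 - r != 0 by rewrite subr_eq0 gt_eqF // (lt_trans lamR_lt0).
suff [] : runfree m * ((1 - L)^-1 - (1 - r)^-1) = L ^+ m / (1 - L) - r ^+ m / (1 - r) /\
  runfree m.+1 * ((1 - L)^-1 - (1 - r)^-1)
    = L ^+ m.+1 / (1 - L) - r ^+ m.+1 / (1 - r) by [].
elim: m => [|m [h0 h1]].
  by rewrite /= !expr0 !expr1 !mul1r; split => //; field; rewrite nL nr.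
split=> //; rewrite runfreeSS mulrDl -(mulrA (1 - p)) h1 -(mulrA (p * _)) h0.
rewrite -(addn2 m) -(addn1 m) !exprD !expr1 lamPF_root lamR_root -/L -/r.
by ring.
Qed.

(* The lamPF ^+ m factors cancel against the normalisation |a| = - r / L. *)
Lemma g_p_runfree m : g_p p (Some m.+2) = runfree m.+2 / runfree m.+1.
Proof.
have L0 : L != 0 by rewrite gt_eqF // lamPF_gt0.
have Lm : L ^+ m.+1 != 0 by rewrite expf_neq0.
have nL : 1 - L != 0 by rewrite subr_eq0 gt_eqF // lamPF_lt1.
have nr : 1 - r != 0 by rewrite subr_eq0 gt_eqF // (lt_trans lamR_lt0).
have c0 : (1 - L)^-1 - (1 - r)^-1 != 0.
  rewrite subr_eq0; apply/eqP => /invr_inj /addrI /oppr_inj e.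
  by have := lamPF_gt0; have := lamR_lt0; rewrite -/L -/r e => /lt_trans h /h; rewrite ltxx.
have absa : `|aconst p| = - (r / L).
  by rewrite /aconst ltr0_norm // pmulr_llt0 ?invr_gt0 ?lamPF_gt0 // lamR_lt0.
have sgn n : (-1) ^+ n.+1 * (- (r / L)) ^+ n = - (r / L) ^+ n.
  by rewrite exprS -mulrA -exprMn !mulN1r opprK.
rewrite /g_p absa -/L -/r.
rewrite -[m.+2.-1]/m.+1 !sgn.
have -> : runfree m.+2 / runfree m.+1 =
   (runfree m.+2 * ((1 - L)^-1 - (1 - r)^-1)) /
   (runfree m.+1 * ((1 - L)^-1 - (1 - r)^-1)).
  by rewrite -mulf_div divff // mulr1.
rewrite !runfree_closed_form.
set N := (X in X / _ = _); set M := (X in _ / X = _).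
have -> : N / M = (N * L ^+ m.+1) / (M * L ^+ m.+1).
  by rewrite -mulf_div divff // mulr1.
congr (_ / _).
  rewrite /N expr_div_n [L ^+ m.+2]exprS.
  by field; rewrite L0 nL nr Lm.
rewrite /M expr_div_n.
by field; rewrite nL nr Lm.
Qed.

Lemma g_p_bounds o : 0 <= g_p p o <= 1.
Proof.
case: o => [[|[|m]]|].
- by rewrite /= lexx ler01.
- by rewrite /= subr_ge0 (ltW p_lt1) gerBl ltW.
- rewrite g_p_runfree; apply/andP; split.
    by rewrite divr_ge0 // ltW // runfree_gt0.
  by rewrite ler_pdivrMr ?runfree_gt0 // mul1r runfree_le.
- by rewrite /= (ltW lamPF_gt0) (ltW lamPF_lt1).
Qed.

End RunFree.

(** * Spins, locality and the distance to the last occupied pair *)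

Lemma eq_OmegaP (w w' : OmegaP) : (forall j, spin j w = spin j w') -> w = w'.
Proof.
case: w w' => [w hw] [w' hw'] /= h; apply: eq_exist; apply/funext => j.
exact: h.
Qed.

Lemma spin_shift k j w : spin j (shift k w) = spin (j + k) w.
Proof. by []. Qed.

Definition agree (x : int) (w w' : OmegaP) :=
  forall j, j <= x -> spin j w = spin j w'.

Lemma agreeS x y w w' : x <= y -> agree y w w' -> agree x w w'.
Proof. by move=> xy h j jx; apply: h; apply: le_trans jx xy. Qed.

Lemma agree_sym x w w' : agree x w w' -> agree x w' w.
Proof. by move=> h j jx; rewrite h. Qed.

(** The sets that cannot separate configurations agreeing up to [x] form a sigma-algebra containing
    the generators. *)
Lemma measurable_agree (x : int) (A : set (OmegaLe x)) (w w' : OmegaP) :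
  measurable A -> agree x w w' -> A w -> A w'.
Proof.
move=> mA.
pose X := [set B : set OmegaP | forall w w', agree x w w' -> B w -> B w'].
suff : X A by move=> XA /XA.
have sX : sigma_algebra setT X.
  split.
  - by move=> ? ? _ [].
  - move=> B XB v v' vv' [_ nB]; split=> // Bv'; apply: nB.
    by apply: XB Bv'; apply: agree_sym.
  - by move=> F XF v v' vv' [i _ Fi]; exists i => //; apply: XF Fi.
apply: (smallest_sub sX _ mA) => B [j [b [jx ->]]] v v' vv' /=.
by rewrite vv'.
Qed.

Lemma measurable_fun_agree (R : realType) (x : int) (f : OmegaLe x -> \bar R)
    (w w' : OmegaP) :
  measurable_fun setT f -> agree x w w' -> f w = f w'.
Proof.
move=> mf ww'.
have mA : measurable (f @^-1` [set f w]).
  by rewrite -[X in measurable X]setTI; apply: mf => //; exact: emeasurable_set1.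
by have := measurable_agree mA ww' erefl; rewrite /preimage /= => ->.
Qed.

Lemma measurable_spin (x j : int) : j <= x ->
  measurable_fun setT (spin j : OmegaLe x -> bool).
Proof.
move=> jx; apply: (measurable_fun_bool true); rewrite setTI.
by apply: sub_sigma_algebra; exists j, true.
Qed.

Lemma measurable_OmegaLe d (T : measurableType d) (x : int) (phi : T -> OmegaLe x) :
  (forall j, j <= x -> measurable_fun setT (fun t => spin j (phi t))) ->
  measurable_fun setT phi.
Proof.
move=> h; apply: (measurability (spin_events_le x : set (set (OmegaLe x)))) => //.
move=> _ [_ [j [b [jx ->]]] <-].
exact: (h j jx measurableT [set b]).
Qed.

Lemma measurable_bool_eq d (T : measurableType d) (f : T -> bool) (b : bool) :
  measurable_fun setT f -> measurable [set t | f t = b].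
Proof.
move=> mf; rewrite -[X in measurable X]setTI.
exact: (mf measurableT [set b]).
Qed.

Lemma measurable_OmegaLeS (x y : int) (A : set OmegaP) : x <= y ->
  measurable (A : set (OmegaLe x)) -> measurable (A : set (OmegaLe y)).
Proof.
move=> xy mA; rewrite -[A]setTI.
have mi : measurable_fun setT (id : OmegaLe y -> OmegaLe x).
  by apply: measurable_OmegaLe => j jx; apply: measurable_spin; apply: le_trans jx xy.
exact: (mi measurableT _ mA).
Qed.

Lemma measurable_funS_OmegaLe d (T : measurableType d) (x y : int) (f : OmegaP -> T) :
  x <= y -> measurable_fun setT (f : OmegaLe x -> T) ->
  measurable_fun setT (f : OmegaLe y -> T).
Proof.
by move=> xy mf _ Y mY; apply: (measurable_OmegaLeS xy); exact: mf.
Qed.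

Lemma OmegaP_neighbour (w : OmegaP) j : spin j w -> spin (j - 1) w || spin (j + 1) w.
Proof. exact: (svalP w j). Qed.

(** The level sets of [n_of] expressed by single spins, which makes them visibly measurable. In
    Omega' the sites after the last pair are all empty, except when site -1 is occupied and -2 is
    not. *)
Definition past_shape (o : option nat) (w : OmegaP) : Prop :=
  match o with
  | Some 0%N => spin (-1) w /\ ~~ spin (-2) w
  | Some k.+1 => [/\ spin (- (k.+2)%:Z) w, spin (- (k.+1)%:Z) w &
                     forall j : nat, (0 < j <= k)%N -> ~~ spin (- j%:Z) w]
  | None => forall j : nat, (0 < j)%N -> ~~ spin (- j%:Z) w
  end.

Lemma pairAtE w k : pairAt w k.+1 = spin (- (k.+2)%:Z) w && spin (- (k.+1)%:Z) w.
Proof. by rewrite /pairAt /= (_ : - k.+1%:Z - 1 = - k.+2%:Z) //; lia. Qed.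

(** An occupied neighbour on the left gives a pair ending at distance [j], one on the right a pair
    ending at [j - 1]. For [j = 1] the right neighbour is the origin, outside the past; there the
    first hypothesis supplies site -2. *)
Lemma occupied_pair w j :
  ~~ (spin (-1) w && ~~ spin (-2) w) -> (0 < j)%N -> spin (- j%:Z) w ->
  exists2 i, (i <= j)%N & pairAt w i.
Proof.
move=> nw; case: j => [//|j] _ wj.
case/orP: (OmegaP_neighbour wj) => h.
  exists j.+1 => //; rewrite pairAtE wj andbT.
  by move: h; rewrite (_ : - j.+1%:Z - 1 = - j.+2%:Z) //; lia.
case: j wj h => [|j] wj h.
  exists 1%N => //; rewrite pairAtE wj andbT.
  by move: nw wj; rewrite (_ : - 1%:Z = -1) // => /[swap] -> /=; rewrite negbK.
exists j.+1 => //; rewrite pairAtE wj /=.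
by move: h; rewrite (_ : - j.+2%:Z + 1 = - j.+1%:Z) //; lia.
Qed.

Lemma past_shape_n_of w : past_shape (n_of w) w.
Proof.
rewrite /n_of; case: ifP => [/andP[]//|/negbT nw].
case: pselect => [h|h] /=.
  case: ex_minnP => -[|k]; first by rewrite /pairAt ltnn.
  rewrite pairAtE => /andP[h1 h2] hm; split=> // j /andP[j0 jk].
  apply/negP => wj; have [i ij pi] := occupied_pair nw j0 wj.
  by have := hm _ pi; lia.
move=> j j0; apply/negP => wj.
by have [i ij pi] := occupied_pair nw j0 wj; apply: h; exists i.
Qed.

(** Taking [None] as the largest distance, the larger of two distinct distances demands an empty
    site where the smaller one demands an occupied one. *)
Lemma past_shape_inj w o o' : past_shape o w -> past_shape o' w -> o = o'.
Proof.
wlog : o o' / match o, o' with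
              | None, _ => True | Some _, None => False
              | Some k, Some k' => (k' <= k)%N end.
  move=> H h h'; case: o o' H h h' => [k|] [k'|] H h h'.
  - by have [kk|/ltnW kk] := leqP k' k; [apply: H | apply/esym; apply: H].
  - by apply/esym; apply: H.
  - exact: H.
  - by [].
case: o o' => [[|k]|] [[|k']|] //=.
(* Distances 0 and 1 both have site -1 occupied; they conflict at site -2 instead. *)
- move=> _ [h1 h2 h3] [h4 h5]; case: k h1 h2 h3 => [|k] h1 h2 h3.
    by move: h5; rewrite h1.
  by have := h3 1%N isT; rewrite h4.
- rewrite ltnS leq_eqVlt => /predU1P[->//|kk] [h1 h2 h3] [h4 h5 h6].
  by have := h3 k'.+1; rewrite h5 kk => /(_ isT).
- by move=> _ h [h1]; rewrite (negbTE (h 1%N isT)) in h1 *.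
- by move=> _ h [h1 h2]; rewrite (negbTE (h k'.+1 isT)) in h2.
Qed.

Lemma n_ofP w o : n_of w = o <-> past_shape o w.
Proof.
split=> [<-|h]; first exact: past_shape_n_of.
exact: past_shape_inj (past_shape_n_of w) h.
Qed.

Lemma measurable_past_shape (l : int) o :
  measurable [set w : OmegaLe (l - 1) | past_shape o (shift l w)].
Proof.
have ms (j : nat) b : (0 < j)%N ->
    measurable [set w : OmegaLe (l - 1) | spin (- j%:Z + l) w = b].
  by move=> j0; apply: measurable_bool_eq; apply: measurable_spin; lia.
have mz (P : set nat) : (forall j, P j -> (0 < j)%N) ->
    measurable [set w : OmegaLe (l - 1) | forall j : nat, P j -> ~~ spin (- j%:Z + l) w].
  move=> hP.
  rewrite (_ : [set _ | _] =
    \bigcap_(j in P) [set w : OmegaLe (l - 1) | spin (- j%:Z + l) w = false]); last first.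
    by apply/seteqP; split=> w /= h j Pj; [apply/negbTE/h | apply/negbT/h].
  by apply: bigcap_measurableType => j Pj; apply: ms; apply: hP.
case: o => [[|k]|] /=.
- rewrite (_ : [set _ | _] = [set w : OmegaLe (l - 1) | spin (- 1%:Z + l) w = true] `&`
    [set w : OmegaLe (l - 1) | spin (- 2%:Z + l) w = false]).
    by apply: measurableI; apply: ms.
  apply/seteqP; split=> w /= [h1 h2]; split=> //; first exact/negbTE.
  exact/negbT.
- rewrite (_ : [set _ | _] = [set w : OmegaLe (l - 1) | spin (- k.+2%:Z + l) w = true] `&`
    [set w : OmegaLe (l - 1) | spin (- k.+1%:Z + l) w = true] `&`
    [set w : OmegaLe (l - 1) | forall j : nat, (0 < j <= k)%N -> ~~ spin (- j%:Z + l) w]).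
    apply: measurableI; first by apply: measurableI; apply: ms.
    by apply: (mz [set j | (0 < j <= k)%N]) => j /andP[].
  by apply/seteqP; split=> w /= [] => [h1 h2 h3|[h1 h2] h3].
- exact: (mz [set j | (0 < j)%N]).
Qed.

(** As [option nat] is countable, every preimage is a countable union of shape sets. *)
Lemma measurable_n_of d (T : measurableType d) (l : int) (h : option nat -> T) :
  measurable_fun setT ((fun w => h (n_of (shift l w))) : OmegaLe (l - 1) -> T).
Proof.
move=> _ Y mY; rewrite setTI.
rewrite (_ : _ @^-1` _ = \bigcup_o
  (if h o \in Y then [set w : OmegaLe (l - 1) | past_shape o (shift l w)] else set0)).
  apply: countable_bigcupT_measurable => // o.
  by case: ifP => _ //; exact: measurable_past_shape.
apply/seteqP; split=> w /=.
  move=> hY; exists (n_of (shift l w)) => //; rewrite mem_set //.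
  exact: past_shape_n_of.
by case=> o _; case: ifP => // /set_mem hY /n_ofP ->.
Qed.

(** * The kernels *)

(* Site [l] is occupied when [b] holds or when the past forces it; the sites
   after [l] are filled with ones, which keeps the configuration in Omega'
   and is invisible to F_{<= l}. *)
Definition extend_config (w : OmegaP) (l : int) (b : bool) : config := fun j =>
  if j < l then spin j w
  else (j != l) || b || (spin (l - 1) w && ~~ spin (l - 2) w).

(** Sites from [l] on have an occupied right neighbour. To the left, only [l - 1] can lack an
    occupied neighbour, namely when [l - 2] is empty, and then the forcing clause occupies [l]. *)
Lemma extend_OmegaP w l b : OmegaP_pred (extend_config w l b).
Proof.
move=> i; rewrite /extend_config.
have [il|il] := ltP i l; last first.
  move=> _; rewrite (_ : (i + 1 < l) = false); last by lia.
  by rewrite (_ : i + 1 != l) ?orbT //; lia.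
move=> wi; rewrite (_ : i - 1 < l); last by lia.
have [//|nh] := boolP (spin (i - 1) w).
have [il'|il'] := ltP (i + 1) l.
  by have := OmegaP_neighbour wi; rewrite (negbTE nh).
have il1 : i = l - 1 by lia.
have il2 : i - 1 = l - 2 by lia.
by rewrite -il1 -il2 wi nh !orbT.
Qed.

Definition extend (w : OmegaP) (l : int) (b : bool) : OmegaP :=
  exist _ (extend_config w l b) (@extend_OmegaP w l b).

Lemma spin_extend_lt w l b j : j < l -> spin j (extend w l b) = spin j w.
Proof. by move=> jl; rewrite /spin /= /extend_config jl. Qed.

Lemma spin_extend w l b :
  spin l (extend w l b) = b || (spin (l - 1) w && ~~ spin (l - 2) w).
Proof. by rewrite /spin /= /extend_config ltxx eqxx. Qed.

Lemma agree_extend w l b : agree (l - 1) (extend w l b) w.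
Proof. by move=> j jl; apply: spin_extend_lt; lia. Qed.

(** The forcing clause never overrides the true spin: if [l] is empty and [l - 1] occupied, then
    [l - 2] is occupied. *)
Lemma agree_extend_spin w l : agree l (extend w l (spin l w)) w.
Proof.
move=> j; rewrite le_eqVlt => /predU1P[->|]; last exact: spin_extend_lt.
rewrite spin_extend; have [//|nl /=] := boolP (spin l w).
apply/negbTE; apply/negP => /andP[h1 h2].
have := OmegaP_neighbour h1; rewrite subrK (negbTE nl) orbF.
by rewrite (_ : l - 1 - 1 = l - 2) ?(negbTE h2) //; lia.
Qed.

Lemma shift_extend w i b :
  shift (- i) (extend (shift i w) 0 b) = extend w i b.
Proof.
apply: eq_OmegaP => j; rewrite spin_shift /spin /= /extend_config subr_lt0 subr_eq0.
by rewrite !spin_shift subrK (addrC i (-1)) (addrC i (-2)) !add0r.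
Qed.

Lemma shift0 w : shift 0 w = w.
Proof. by apply: eq_OmegaP => j; rewrite spin_shift addr0. Qed.

Lemma measurable_extend (l : int) (b : bool) :
  measurable_fun setT ((fun w => extend w l b) : OmegaLe (l - 1) -> OmegaLe l).
Proof.
apply: measurable_OmegaLe => j jl; rewrite /spin /= /extend_config.
have [jl'|jl'] := ltP j l; first by apply: measurable_spin; lia.
apply: measurable_or; first exact: measurable_cst.
apply: measurable_and; first by apply: measurable_spin.
by apply: measurable_neg; apply: measurable_spin; lia.
Qed.

Section Kernel.
Variables (R : realType) (g : option nat -> R).
Hypothesis g01 : forall o, 0 <= g o <= 1.

Definition weight (o : option nat) (b : bool) : R := if b then 1 - g o else g o.

Lemma weight_ge0 o b : 0 <= weight o b.
Proof. by case/andP: (g01 o) => h0 h1; case: b; rewrite /weight //= subr_ge0. Qed.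

Arguments weight : simpl never.

Local Notation wgt l w b := (NngNum (weight_ge0 (n_of (shift l w)) b)).

Fixpoint kmeas (m : int) (n : nat) (l : int) (w : OmegaP) :
    {measure set (OmegaLe m) -> \bar R} :=
  match n with
  | 0%N => \d_(w : OmegaLe m)
  | n'.+1 => measure_add
      (mscale (wgt l w false) (kmeas m n' (l + 1) (extend w l false)))
      (mscale (wgt l w true) (kmeas m n' (l + 1) (extend w l true)))
  end.

Local Open Scope ereal_scope.

(** Expectation under [kmeas] as a finite sum. It carries no sigma-algebra, so kernels of different
    intervals compose freely in it. *)
Fixpoint kexp (n : nat) (l : int) (f : OmegaP -> \bar R) (w : OmegaP) : \bar R :=
  match n with
  | 0%N => f w
  | n'.+1 =>
      (weight (n_of (shift l w)) false)%:E * kexp n' (l + 1) f (extend w l false) +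
      (weight (n_of (shift l w)) true)%:E * kexp n' (l + 1) f (extend w l true)
  end.

Lemma kmeas_kexp m n l w A :
  kmeas m n l w A = kexp n l (fun x => (\1_A x)%:E) w.
Proof.
elim: n l w => [|n IH] l w /=; first by rewrite diracE indicE.
by apply: etrans (measure_addE _ _ _) _; rewrite -!IH.
Qed.

Lemma kexp_ge0 n l f w : (forall x, 0 <= f x) -> 0 <= kexp n l f w.
Proof.
move=> f0; elim: n l w => [|n IH] l w //=.
by rewrite adde_ge0 // mule_ge0 // lee_fin weight_ge0.
Qed.

Lemma integral_kmeas m n l w (f : OmegaLe m -> \bar R) :
  measurable_fun setT f -> (forall x, 0 <= f x) ->
  \int[kmeas m n l w]_x f x = kexp n l f w.
Proof.
move=> mf f0; elim: n l w => [|n IH] l w /=.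
  by rewrite integral_dirac // diracT mul1e.
by rewrite ge0_integral_measure_add // !ge0_integral_mscale //= !IH.
Qed.

Lemma weightD o (x : \bar R) :
  (weight o false)%:E * x + (weight o true)%:E * x = x.
Proof.
rewrite -ge0_muleDl ?lee_fin ?weight_ge0 // -EFinD /weight.
by rewrite addrC subrK mul1e.
Qed.

(** Filling sites from [l] on does not affect [f], and the two weights add up to 1. This yields
    total mass one, properness, and both reductions in the tower property. *)
Lemma kexp_local n l f w :
  (forall v v', agree (l - 1) v v' -> f v = f v') -> kexp n l f w = f w.
Proof.
elim: n l w => [|n IH] l w //= fl.
rewrite !IH; first by rewrite !(fl _ w) ?weightD //; exact: agree_extend.
  by move=> v v' h; apply: fl; apply: agreeS h; lia.
by move=> v v' h; apply: fl; apply: agreeS h; lia.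
Qed.

Lemma eq_kexp n l f f' w : f =1 f' -> kexp n l f w = kexp n l f' w.
Proof. by move=> ff'; elim: n l w => [|n IH] l w //=; rewrite !IH. Qed.

Lemma kexpD n n' l f w :
  kexp (n + n') l f w = kexp n l (kexp n' (l + n%:Z)%R f) w.
Proof.
elim: n l w => [|n IH] l w /=; first by rewrite add0n addr0.
by rewrite !IH (_ : (l + 1 + n%:Z = l + n.+1%:Z)%R) //; lia.
Qed.

(** The equation says that the [n] filled sites are exactly those of [l, m]. *)
Lemma measurable_kexp n (l m : int) (f : OmegaP -> \bar R) :
  (l + n%:Z = m + 1)%R -> measurable_fun setT (f : OmegaLe m -> \bar R) ->
  measurable_fun setT (kexp n l f : OmegaLe (l - 1)%R -> \bar R).
Proof.
move=> + mf; elim: n l => [|n IH] l lm /=.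
  by apply: measurable_funS_OmegaLe mf; lia.
have mk : measurable_fun setT (kexp n (l + 1)%R f : OmegaLe l -> \bar R).
  have := IH (l + 1)%R; rewrite addrK; apply; lia.
apply: emeasurable_funD; apply: emeasurable_funM.
- exact: (@measurable_n_of _ _ l (fun o => (weight o false)%:E)).
- exact: (measurableT_comp mk (@measurable_extend l false)).
- exact: (@measurable_n_of _ _ l (fun o => (weight o true)%:E)).
- exact: (measurableT_comp mk (@measurable_extend l true)).
Qed.

(** For [l <= m] the absolute value is the number of sites of [l, m]. For other indices it is just
    some natural number, and the kernel is still a probability. *)
Definition kprob (l m : int) (w : OmegaP) : set (OmegaLe m) -> \bar R :=
  kmeas m (absz (m - l + 1)%R) l w.

Arguments kprob : clear implicits.

HB.instance Definition _ l m w := Measure.on (kprob l m w).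

Lemma kprob_setT l m w : kprob l m w setT = 1%:E.
Proof. by rewrite /kprob kmeas_kexp kexp_local ?indicT. Qed.

HB.instance Definition _ l m w :=
  Measure_isProbability.Build _ _ _ (kprob l m w) (kprob_setT l m w).

Definition lis : kernel_family R := fun l m w => kprob l m w.

Lemma integral_lis (l m : int) w (f : OmegaLe m -> \bar R) :
  measurable_fun setT f -> (forall x, 0 <= f x) ->
  \int[lis l m w]_x f x = kexp (absz (m - l + 1)%R) l f w.
Proof. exact: integral_kmeas. Qed.

Lemma lis_is_LIS : is_LIS lis.
Proof.
split; [|split].
- move=> l m lm A mA.
  rewrite (_ : (fun w => _) = kexp (absz (m - l + 1)%R) l (fun x => (\1_A x)%:E)).
    apply: (@measurable_kexp _ _ m); first by lia.
    by apply/measurable_EFinP; apply: measurable_indic.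
  by apply/funext => w; rewrite /= /kprob kmeas_kexp.
- move=> l m lm B mB w; rewrite /= /kprob kmeas_kexp kexp_local //.
  move=> v v' vv'; rewrite !indicE; congr (_%:R%:E); congr nat_of_bool.
  apply/idP/idP => /set_mem h; apply/mem_set.
    exact: measurable_agree mB vv' h.
  exact: measurable_agree mB (agree_sym vv') h.
- move=> lL mL lD mD h1 h2 h3 f mf f0 w.
  set F := kexp (absz (mL - lL + 1)%R) lL f.
  have mF : measurable_fun setT (F : OmegaLe (lL - 1)%R -> \bar R).
    by apply: (@measurable_kexp _ _ mL) => //; lia.
  under eq_integral do rewrite integral_lis //.
  transitivity (kexp (absz (mD - lD + 1)%R) lD F w).
    apply: integral_lis; last by move=> x; apply: kexp_ge0.
    by apply: measurable_funS_OmegaLe mF; lia.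
  rewrite integral_lis //; last exact: measurable_funS_OmegaLe mf.
  (* Cut the large interval into the sites before, inside and after the small one. From [lL] on,
     filling leaves [F] fixed; after [mL] it leaves [f] fixed. *)
  rewrite (_ : absz (mD - lD + 1)%R =
    (absz (lL - lD)%R + (absz (mL - lL + 1)%R + absz (mD - mL)%R))%N); last by lia.
  rewrite !(kexpD (absz (lL - lD)%R)).
  rewrite (_ : (lD + (absz (lL - lD)%R)%:Z)%R = lL); last by lia.
  apply: eq_kexp => x; rewrite kexp_local.
    rewrite kexpD; apply: eq_kexp => y.
    rewrite kexp_local // => v v'.
    rewrite (_ : (lL + (absz (mL - lL + 1)%R)%:Z - 1)%R = mL); last by lia.
    exact: measurable_fun_agree.
  by move=> v v'; apply: measurable_fun_agree.
Qed.

Lemma lis_single i w A :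
  lis i i w A = (weight (n_of (shift i w)) false)%:E * (\1_A (extend w i false))%:E +
                (weight (n_of (shift i w)) true)%:E * (\1_A (extend w i true))%:E.
Proof. by rewrite /= /kprob kmeas_kexp subrr add0r. Qed.

Lemma lis_translation_invariant : LIS_translation_invariant lis.
Proof.
move=> i w A mA; rewrite !lis_single shift0.
by rewrite -(shift_extend w i false) -(shift_extend w i true).
Qed.

Local Close Scope ereal_scope.

(** At distance 0 both fillings give spin 1, so spin 0 has mass zero; this is the prescribed law
    exactly because [g] vanishes there. *)
Lemma lis_spin0 w : g (Some 0%N) = 0 ->
  lis 0 0 w [set w' | spin 0 w' = false] = (g (n_of w))%:E /\
  lis 0 0 w [set w' | spin 0 w' = true] = (1 - g (n_of w))%:E.
Proof.
move=> g0; rewrite !lis_single shift0 !indicE.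
have spinE b : (extend w 0 b \in [set w' | spin 0 w' = true]) = spin 0 (extend w 0 b).
  by apply/idP/idP => [/set_mem|] // h; apply/mem_set.
have spinE' b : (extend w 0 b \in [set w' | spin 0 w' = false]) = ~~ spin 0 (extend w 0 b).
  by apply/idP/idP => [/set_mem /= ->|h] //; apply/mem_set; apply/negbTE.
rewrite !spinE !spinE' !spin_extend !add0r /weight /=.
have [h|h] := boolP (spin (-1) w && ~~ spin (-2) w); last first.
  by rewrite !mule1 !mule0 add0e adde0.
have -> : n_of w = Some 0%N by apply/n_ofP; case/andP: h.
by rewrite g0 /= !mule1 !mule0 !subr0 !add0e.
Qed.

End Kernel.

(** * Integrals of functions of a proportionally distributed variable *)

Lemma ge0_integral_mrestr d (T : measurableType d) (R : realType)
    (mu : {measure set T -> \bar R}) (D : set T) (mD : measurable D)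
    (f : T -> \bar R) :
  measurable_fun setT f -> (forall x, 0 <= f x)%E ->
  (\int[mrestr mu mD]_x f x = \int[mu]_(x in D) f x)%E.
Proof.
move=> mf f0; rewrite -(setUv D) ge0_integral_setU //; first last.
- by apply/disj_setPS => x [].
- by rewrite setUv.
- exact: measurableC.
rewrite [X in (_ + X)%E]null_set_integral ?adde0.
- by apply: eq_measure_integral => A mA AD; rewrite /= /mrestr setIidl.
- exact: measurableC.
- exact: measurable_funTS.
- by rewrite /= /mrestr setICl measure0.
Qed.

(** The hypothesis compares the images under [phi] of [mu] restricted to [D1] and to [D2]; the
    integrals are those of [f] against these images. *)
Lemma integral_proportional d d' (T : measurableType d) (T' : measurableType d')
    (R : realType) (mu : {measure set T -> \bar R}) (phi : T -> T')
    (D1 D2 : set T) (c : R) (f : T' -> \bar R) :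
  measurable_fun setT phi -> measurable D1 -> measurable D2 -> 0 <= c ->
  (forall A, measurable A ->
     mu (phi @^-1` A `&` D1) = c%:E * mu (phi @^-1` A `&` D2))%E ->
  measurable_fun setT f -> (forall x, 0 <= f x)%E ->
  (\int[mu]_(x in D1) f (phi x) = c%:E * \int[mu]_(x in D2) f (phi x))%E.
Proof.
move=> mphi mD1 mD2 c0 h mf f0.
have mfphi : measurable_fun setT (f \o phi) by apply: measurableT_comp.
pose nu D (mD : measurable D) : {measure set T' -> \bar R} :=
  pushforward (mrestr mu mD) phi.
have push D (mD : measurable D) :
    (\int[mu]_(x in D) f (phi x) = \int[nu mphi D mD]_y f y)%E.
  rewrite [RHS](ge0_integral_pushforward mphi) // preimage_setT.
  by apply/esym; apply: ge0_integral_mrestr => // x; exact: f0.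
rewrite !push -(ge0_integral_mscale _ _ (NngNum c0)) //.
by apply: eq_measure_integral => A mA _; exact: h.
Qed.

(** * Independence of the past under the Bernoulli measure *)

Definition cylinder (s : seq int) (v : int -> bool) : set config :=
  [set w | forall i, i \in s -> w i = v i].

(* A pi-system generating the spins at sites strictly left of [x]. *)
Definition past_cylinders (x : int) : set (set config) :=
  [set A | A = set0 \/ exists s v,
     [/\ uniq s, {in s, forall i, i < x} & A = cylinder s v]].

Definition OmegaPast (x : int) := g_sigma_algebraType (past_cylinders x).

Lemma measurable_Omega_spin (j : int) :
  measurable_fun setT ((fun w => w j) : Omega -> bool).
Proof.
apply: (measurable_fun_bool true); rewrite setTI.
by apply: sub_sigma_algebra; exists j, true.
Qed.

Lemma measurable_past_spin (x j : int) : j < x ->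
  measurable_fun setT ((fun w => w j) : OmegaPast x -> bool).
Proof.
move=> jx; apply: (measurable_fun_bool true); rewrite setTI.
apply: sub_sigma_algebra; right; exists [:: j], (fun=> true); split=> //.
  by move=> i; rewrite inE => /eqP ->.
apply/seteqP; split=> w /=; first by move=> wj i; rewrite inE => /eqP ->.
by apply; rewrite inE.
Qed.

Lemma measurable_cylinder s v : measurable (cylinder s v : set Omega).
Proof.
elim: s => [|a s IH].
  by rewrite (_ : cylinder _ _ = setT) //; apply/seteqP; split.
rewrite (_ : cylinder _ _ = [set w : Omega | w a = v a] `&` cylinder s v).
  by apply: measurableI => //; apply: measurable_bool_eq; exact: measurable_Omega_spin.
apply/seteqP; split=> w /=.
  by move=> h; split=> [|i si]; apply: h; rewrite inE ?eqxx ?si ?orbT.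
by move=> [h1 h2] i; rewrite inE => /predU1P[->//|]; exact: h2.
Qed.

Lemma past_cylinders_measurable x A : past_cylinders x A -> measurable (A : set Omega).
Proof.
by move=> [->|[s [v [_ _ ->]]]]; [exact: measurable0|exact: measurable_cylinder].
Qed.

Lemma past_measurable (x : int) (A : set config) :
  measurable (A : set (OmegaPast x)) -> measurable (A : set Omega).
Proof.
apply: (@smallest_sub _ (sigma_algebra setT)); first exact: sigma_algebra_measurable.
exact: past_cylinders_measurable.
Qed.

Lemma past_measurableS (x y : int) (A : set config) : x <= y ->
  measurable (A : set (OmegaPast x)) -> measurable (A : set (OmegaPast y)).
Proof.
move=> xy; apply: (@smallest_sub _ (sigma_algebra setT)).
  exact: smallest_sigma_algebra.
move=> B [->|[s [v [us sx ->]]]]; apply: sub_sigma_algebra; first by left.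
by right; exists s, v; split=> // i si; apply: lt_le_trans (sx i si) xy.
Qed.

(** Incompatible prescriptions meet in [set0], whence its place in the pi-system. Otherwise any
    common point serves as prescription on the union of the sites. *)
Lemma past_cylinders_setI x : setI_closed (past_cylinders x).
Proof.
move=> A B [->|[s [v [us sx ->]]]]; first by rewrite set0I; left.
move=> [->|[t [u [ut tx ->]]]]; first by rewrite setI0; left.
have [[w [ws wt]]|no] := pselect (cylinder s v `&` cylinder t u !=set0).
  right; exists (undup (s ++ t)), w; split.
  - exact: undup_uniq.
  - by move=> i; rewrite mem_undup mem_cat => /orP[/sx|/tx].
  - apply/seteqP; split=> z /=.
      move=> [zs zt] i; rewrite mem_undup mem_cat => /orP[h|h].
        by rewrite zs // ws.
      by rewrite zt // wt.
    move=> h; split=> i hi; rewrite h ?mem_undup ?mem_cat ?hi ?orbT //.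
      exact: ws.
    exact: wt.
by left; apply/seteqP; split=> z // hz; apply: no; exists z.
Qed.

Definition no_pair (x : int) (m : nat) : set config :=
  [set w | forall j : nat, (j.+1 < m)%N -> ~~ (w (x + j%:Z) && w (x + j%:Z + 1))].

Lemma measurable_no_pair x m : measurable (no_pair x m : set Omega).
Proof.
rewrite (_ : no_pair x m = \bigcap_(j in [set j | (j.+1 < m)%N])
  [set w : Omega | (w (x + j%:Z) && w (x + j%:Z + 1)) = false]).
  apply: bigcap_measurableType => j _; apply: measurable_bool_eq.
  by apply: measurable_and; exact: measurable_Omega_spin.
by apply/seteqP; split=> w h j jm; [apply/negbTE/h|apply/negbT/h].
Qed.

(** Split on the first spin: a 0 frees the block from [x + 1], a 1 forces a 0 and frees it from
    [x + 2]. This is the recursion of [runfree]. *)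
Lemma no_pairSS x m (C : set config) : C `&` no_pair x m.+2 =
  ((C `&` [set w | w x = false]) `&` no_pair (x + 1) m.+1) `|`
  ((C `&` [set w | w x = true] `&` [set w | w (x + 1) = false]) `&` no_pair (x + 2) m).
Proof.
apply/seteqP; split=> w /=.
  move=> [Cw h]; have := h 0%N isT; rewrite addr0.
  case wx: (w x) => /=.
    move=> wx1; right; split; first by split; [split|apply/negbTE].
    move=> j jm; have := h j.+2; rewrite !ltnS => /(_ jm).
    by rewrite (_ : x + j.+2%:Z = x + 2 + j%:Z) //; lia.
  move=> _; left; split=> // j jm; have := h j.+1; rewrite !ltnS => /(_ jm).
  by rewrite (_ : x + j.+1%:Z = x + 1 + j%:Z) //; lia.
move=> [[[Cw wx] h]|[[[Cw wx] wx1] h]]; split=> // -[|j] jm.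
- by rewrite addr0 wx.
- by rewrite (_ : x + j.+1%:Z = x + 1 + j%:Z) ?h //; lia.
- by rewrite addr0 wx1 andbF.
- case: j jm => [|j] jm.
    by rewrite wx1.
  by rewrite (_ : x + j.+2%:Z = x + 2 + j%:Z) ?h //; lia.
Qed.

Section Bernoulli.
Variables (R : realType) (p : R) (mu : probability Omega R).
Hypotheses (p_gt0 : 0 < p) (p_lt1 : p < 1) (hmu : is_bernoulli_product p mu).

Local Notation pb b := (if b then p else 1 - p).

Lemma pb_ge0 (b : bool) : 0 <= pb b.
Proof. by case: b; rewrite ?subr_ge0 ltW. Qed.

(** Both sides are finite measures in [C], and they agree on past cylinders, where adding site [x]
    contributes one more factor to the product. *)
Lemma past_indep (x : int) (b : bool) (C : set config) :
  measurable (C : set (OmegaPast x)) ->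
  (mu (C `&` [set w | w x = b]) = mu C * (pb b)%:E)%E.
Proof.
have mb : measurable [set w : Omega | w x = b].
  by apply: measurable_bool_eq; exact: measurable_Omega_spin.
move=> mC; rewrite muleC.
apply: (@g_sigma_algebra_measure_unique _ R Omega (past_cylinders x) _ (fun=> setT)
  _ _ (mrestr mu mb) (mscale (NngNum (pb_ge0 b)) mu)) => //.
- exact: past_cylinders_measurable.
- move=> _; right; exists [::], (fun=> true); split=> //.
  by apply/seteqP; split.
- by apply/seteqP; split=> // w _; exists 0%N.
- exact: past_cylinders_setI.
- move=> A [->|[s [v [us sx ->]]]]; first by rewrite !measure0.
  have xs : x \notin s by apply/negP => /sx; rewrite ltxx.
  pose v' i := if i == x then b else v i.
  have v's i : i \in s -> v' i = v i.
    by rewrite /v'; case: eqP => // -> xs'; rewrite xs' in xs.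
  rewrite /= /mrestr /mscale /= (hmu _ us) -EFinM.
  rewrite (_ : _ `&` _ = cylinder (x :: s) v').
    rewrite (hmu v') /= ?xs // big_cons {1}/v' eqxx; congr (_ * _)%:E.
    by apply: eq_big_seq => i si; rewrite v's.
  apply/seteqP; split=> w /=.
    move=> [h1 h2] i; rewrite inE => /predU1P[->|si]; first by rewrite /v' eqxx.
    by rewrite v's // h1.
  move=> h; split=> [i si|]; first by rewrite h ?v's // inE si orbT.
  by rewrite h ?inE ?eqxx // /v' eqxx.
- move=> _; rewrite /= /mrestr setTI.
  by rewrite (le_lt_trans (probability_le1 _ _)) ?ltry.
Qed.

(** Induction on two consecutive lengths, uniformly in [x] and [C], since each split moves one or
    two sites from the block into the past event. *)
Lemma past_no_pair m x C : measurable (C : set (OmegaPast x)) ->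
  (mu (C `&` no_pair x m) = mu C * (runfree p m)%:E)%E.
Proof.
suff [] : (forall x C, measurable (C : set (OmegaPast x)) ->
    (mu (C `&` no_pair x m) = mu C * (runfree p m)%:E)%E) /\
  (forall x C, measurable (C : set (OmegaPast x)) ->
    (mu (C `&` no_pair x m.+1) = mu C * (runfree p m.+1)%:E)%E) by move=> h _; exact: h.
elim: m {x C} => [|m [IH0 IH1]].
  by split=> x C mC; rewrite (_ : no_pair _ _ = setT) ?setIT ?mule1 //;
    apply/seteqP; split.
split=> // x C mC.
have mx (y z : int) b : y < z -> measurable ([set w | w y = b] : set (OmegaPast z)).
  by move=> yz; apply: measurable_bool_eq; exact: measurable_past_spin.
have m1 b : measurable (C `&` [set w | w x = b] : set (OmegaPast (x + 1))).
  by apply: measurableI; [apply: past_measurableS mC; lia|apply: mx; lia].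
have m2 : measurable (C `&` [set w | w x = true] `&` [set w | w (x + 1) = false]
    : set (OmegaPast (x + 2))).
  by apply: measurableI; [apply: past_measurableS (m1 _); lia|apply: mx; lia].
rewrite no_pairSS; set U := (X in mu (X `|` _)); set V := (X in mu (_ `|` X)).
have -> : (mu (U `|` V) = mu U + mu V)%E.
  apply: measureU.
  - by apply: measurableI; [exact: past_measurable (m1 _)|exact: measurable_no_pair].
  - by apply: measurableI; [exact: past_measurable m2|exact: measurable_no_pair].
  - by apply/seteqP; split=> // w /= [[[_ h1] _] [[[_ h2] _] _]]; have := etrans (esym h1) h2.
rewrite {}/U {}/V.
rewrite IH1 // IH0 // (past_indep _ (m1 true)) !past_indep // runfreeSS.
rewrite -(fineK (fin_num_measure mu _ (past_measurable mC))).
by rewrite -!EFinM -EFinD; congr _%:E; ring.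
Qed.

End Bernoulli.

(** * Conditioning the thinned field on its past *)

Definition truncate (x : int) (w : config) : config := fun j => (j <= x) && w j.

(* The visible pattern 1 1 0^n, its second one being at site [x]. *)
Definition gap (x : int) (n : nat) : set config :=
  [set w | [/\ Tmap_config w (x - 1), Tmap_config w x &
               forall j : nat, (0 < j <= n)%N -> ~~ Tmap_config w (x + j%:Z)]].

Lemma gap0 x : gap x 0 = [set w | w (x - 1) = true] `&` [set w | w x = true].
Proof.
apply/seteqP; split=> w /=; rewrite /gap /= /Tmap_config.
  by move=> [/andP[h1 _] /andP[h2 _] _].
move=> [h1 h2]; split; rewrite ?subrK ?h1 ?h2 ?orbT //.
by case.
Qed.

(** Next to the occupied site [x], a visible 0 is a true 0; the later visible zeros only exclude
    adjacent ones. The block reaches [x + n + 2], one site past the gap, because thinning at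
    [x + n + 1] looks at its right neighbour. *)
Lemma gapS x n :
  gap x n.+1 = gap x 0 `&` [set w | w (x + 1) = false] `&` no_pair (x + 2) n.+1.
Proof.
rewrite gap0; apply/seteqP; split=> w /=; rewrite /gap /no_pair /= /Tmap_config.
  move=> [/andP[h1 _] /andP[h2 _] h3]; split.
    split=> //; have := h3 1%N isT.
    by rewrite addrK h2 /= andbT => /negbTE.
  move=> j; rewrite ltnS => jn; have := h3 j.+2; rewrite /= => /(_ jn).
  rewrite (_ : x + j.+2%:Z = x + 2 + j%:Z); last by lia.
  by apply: contra => /andP[-> ->]; rewrite orbT.
move=> [[[h1 h2] h3] h4]; split; rewrite ?subrK ?h1 ?h2 ?orbT //.
move=> [//|[|j]] /= jn; first by rewrite h3.
apply/negP => /andP[wj /orP[wl|wr]].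
  case: j jn wj wl => [|j] jn wj wl.
    by move: wl; rewrite (_ : x + 2%:Z - 1 = x + 1) ?h3 //; lia.
  have /negP := h4 j (ltnW jn); apply.
  rewrite (_ : x + 2 + j%:Z = x + j.+3%:Z - 1) ?wl ?subrK ?wj //; lia.
have /negP := h4 j jn; apply.
by rewrite (_ : x + 2 + j%:Z = x + j.+2%:Z) ?wj //; lia.
Qed.

(** After [x] both thinned fields are empty. At [x] the right neighbour is erased, but the occupied
    left one keeps the particle alive. *)
Lemma gap_agree x n w : gap x n w ->
  agree (x + n%:Z) (Tmap w) (Tmap (truncate x w)).
Proof.
move=> [h1 h2 h3] j jx; rewrite /spin /= /Tmap_config /truncate.
have [jx'|jx'] := leP j x; last first.
  have := h3 (absz (j - x)); rewrite (_ : x + (absz (j - x))%:Z = j); last by lia.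
  by move=> h /=; apply/negbTE; apply: h; lia.
rewrite (_ : j - 1 <= x) /=; last by lia.
have [//|jx1] := leP (j + 1) x.
have jE : j = x by lia.
move: h1; rewrite /Tmap_config => /andP[+ _]; rewrite -jE => ->.
by rewrite !orTb.
Qed.

Lemma measurable_Tmap y : measurable_fun setT (Tmap : Omega -> OmegaLe y).
Proof.
apply: measurable_OmegaLe => j _; rewrite /spin /= /Tmap_config.
by apply: measurable_and; [|apply: measurable_or]; exact: measurable_Omega_spin.
Qed.

Lemma measurable_Tmap_truncate x y :
  measurable_fun setT ((fun w => Tmap (truncate x w)) : OmegaPast (x + 1) -> OmegaLe y).
Proof.
have mt j : measurable_fun setT ((fun w => truncate x w j) : OmegaPast (x + 1) -> bool).
  rewrite /truncate; have [jx|jx] /= := leP j x; last exact: measurable_cst.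
  by apply: measurable_past_spin; lia.
apply: measurable_OmegaLe => j _; rewrite /spin /= /Tmap_config.
by apply: measurable_and; [|apply: measurable_or]; exact: mt.
Qed.

Section ThinnedPast.
Variables (R : realType) (p : R) (mu : probability Omega R).
Hypotheses (p_gt0 : 0 < p) (p_lt1 : p < 1) (hmu : is_bernoulli_product p mu).

(** The conditional probability, given the spins up to a pair ending at [x], of seeing [n] zeros
    after it. *)
Definition gap_mass (n : nat) : R :=
  if n is n'.+1 then (1 - p) * runfree p n'.+1 else 1.

(** On the gap, the thinned past is a function of the spins up to [x], which are independent of the
    spins that produce the zeros. *)
Lemma mu_gap x n (A : set (OmegaLe (x + n%:Z))) : measurable A ->
  (mu (Tmap @^-1` A `&` gap x n) =
   mu ([set w | A (Tmap (truncate x w))] `&` gap x 0) * (gap_mass n)%:E)%E.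
Proof.
move=> mA.
have -> : Tmap @^-1` A `&` gap x n =
    [set w | A (Tmap (truncate x w))] `&` gap x n.
  apply/seteqP; split=> w /= [h1 h2]; split=> //.
    exact: (measurable_agree mA (gap_agree h2) h1).
  exact: (measurable_agree mA (agree_sym (gap_agree h2)) h1).
set C := [set w | A (Tmap (truncate x w))].
have mC : measurable (C `&` gap x 0 : set (OmegaPast (x + 1))).
  apply: measurableI.
    rewrite -[C]setTI; exact: (@measurable_Tmap_truncate x _ measurableT _ mA).
  rewrite gap0; apply: measurableI; apply: measurable_bool_eq;
    by apply: measurable_past_spin; lia.
case: n A mA C mC => [|n] A mA C mC; first by rewrite mule1.
rewrite gapS !setIA (past_no_pair p_gt0 p_lt1 hmu).
  by rewrite (past_indep p_gt0 p_lt1 hmu) // -muleA -EFinM.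
rewrite (_ : x + 2 = x + 1 + 1); last by lia.
apply: measurableI; first by apply: past_measurableS mC; lia.
by apply: measurable_bool_eq; apply: measurable_past_spin; lia.
Qed.

(** After [n] visible zeros the next site is at distance [n + 1] from the pair, so [g_p] at [n + 1]
    is the price of one more zero. *)
Lemma gap_massS n : gap_mass n.+1 = g_p p (Some n.+1) * gap_mass n.
Proof.
case: n => [|n]; first by rewrite /= mulr1.
rewrite g_p_runfree // /gap_mass mulrCA; congr (_ * _).
by rewrite mulfVK // gt_eqF // runfree_gt0.
Qed.

Definition shape_set (l : int) (o : option nat) : set config :=
  [set w | past_shape o (shift l (Tmap w))].

Lemma measurable_shape_set l o : measurable (shape_set l o : set Omega).
Proof.
rewrite -[X in measurable X]setTI.
exact: (@measurable_Tmap (l - 1) measurableT _ (@measurable_past_shape l o)).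
Qed.

Lemma shape_set_gap l n : shape_set l (Some n.+1) = gap (l - n.+1%:Z) n.
Proof.
apply/seteqP; split=> w [h1 h2 h3]; split.
- by rewrite (_ : l - n.+1%:Z - 1 = - n.+2%:Z + l) //; lia.
- by rewrite (_ : l - n.+1%:Z = - n.+1%:Z + l) //; lia.
- move=> j jn; rewrite (_ : l - n.+1%:Z + j%:Z = - (n.+1 - j)%N%:Z + l); last by lia.
  by apply: h3; lia.
- by rewrite spin_shift (_ : - n.+2%:Z + l = l - n.+1%:Z - 1) //; lia.
- by rewrite spin_shift (_ : - n.+1%:Z + l = l - n.+1%:Z) //; lia.
- move=> j jn; rewrite spin_shift.
  rewrite (_ : - j%:Z + l = l - n.+1%:Z + (n.+1 - j)%N%:Z); last by lia.
  by apply: h3; lia.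
Qed.

Lemma gap_split x n :
  gap x n.+1 = gap x n `&` [set w | Tmap_config w (x + n.+1%:Z) = false].
Proof.
apply/seteqP; split=> w /=.
  move=> [h1 h2 h3]; split; last by apply/negbTE/h3; rewrite leqnn.
  by split=> // j jn; apply: h3; lia.
move=> [[h1 h2 h3] h4]; split=> // j /andP[j0].
rewrite leq_eqVlt => /predU1P[->|jn]; first by rewrite h4.
by apply: h3; rewrite j0.
Qed.

Lemma mu_shape_none l : mu (shape_set l None) = 0%E.
Proof.
have mS := measurable_shape_set l None.
have le m : fine (mu (shape_set l None)) <= (1 - p ^+ 2) ^+ m.
  apply: le_trans (runfree_le_expr p_gt0 p_lt1 m).
  rewrite -lee_fin fineK ?fin_num_measure //.
  (* A block of [2m] sites ending at [l - 2]: any adjacent ones in it would survive thinning and be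
     seen in the past. *)
  pose x : int := l - 1 - m.*2%:Z.
  have -> : ((runfree p m.*2)%:E = mu (setT `&` no_pair x m.*2))%E.
    have mT := @measurableT _ (OmegaPast x).
    by rewrite (past_no_pair p_gt0 p_lt1 hmu _ mT) probability_setT mul1e.
  rewrite setTI; apply: le_measure; rewrite ?inE //; first exact: measurable_no_pair.
  move=> w h j jm.
  have jx : (0 < absz (l - x - j%:Z)%R)%N by rewrite /x; lia.
  have := h _ jx; rewrite spin_shift (_ : _ + l = x + j%:Z); last by rewrite /x; lia.
  rewrite /spin /= /Tmap_config; apply: contra => /andP[-> ->].
  by rewrite orbT.
rewrite -(fineK (fin_num_measure mu _ mS)); congr _%:E.
have r0 : 0 <= fine (mu (shape_set l None)) by rewrite fine_ge0.
apply/eqP; rewrite eq_le r0 andbT leNgt; apply/negP => rpos.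
have c1 : `|1 - p ^+ 2| < 1.
  rewrite ger0_norm ?subr_ge0 ?exprn_ile1 ?ltW //.
  by rewrite gtrBl exprn_gt0.
have /cvgrPdist_lt /(_ _ rpos) [N _ /(_ N (leqnn N))] := cvg_expr c1.
rewrite /= sub0r normrN ger0_norm; first by rewrite ltNge le.
by apply: exprn_ge0; rewrite subr_ge0 exprn_ile1 // ltW.
Qed.

(** The one-site conditional law. For spin 0: at distance 0 it would isolate site [l - 1]; at a
    finite positive distance it lengthens the gap after the same pair, so [mu_gap] gives the ratio
    of gap masses; infinite distance is null. Spin 1 follows by complement. *)
Lemma shape_proportion (l : int) (o : option nat) (b : bool)
    (A : set (OmegaLe (l - 1))) :
  measurable A ->
  (mu (Tmap @^-1` A `&` (shape_set l o `&` [set w | Tmap_config w l = b])) =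
   (weight (g_p p) o b)%:E * mu (Tmap @^-1` A `&` shape_set l o))%E.
Proof.
move=> mA.
have mT : measurable (Tmap @^-1` A : set Omega).
  by rewrite -[X in measurable X]setTI; exact: (@measurable_Tmap (l - 1) measurableT _ mA).
have mS := measurable_shape_set l o.
have mb c : measurable ([set w | Tmap_config w l = c] : set Omega).
  apply: measurable_bool_eq.
  by apply: measurable_and; [|apply: measurable_or]; exact: measurable_Omega_spin.
have mTS : measurable (Tmap @^-1` A `&` shape_set l o : set Omega) by exact: measurableI.
have false_case : (mu (Tmap @^-1` A `&` (shape_set l o `&` [set w | Tmap_config w l = false])) =
   (g_p p o)%:E * mu (Tmap @^-1` A `&` shape_set l o))%E.
  case: o mS mTS => [[|n]|] mS mTS.
  - rewrite mul0e (_ : _ `&` _ = set0) ?measure0 //.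
    apply/seteqP; split=> w //= [_ [[h1 h2] h3]].
    have := @OmegaP_neighbour (Tmap w) (-1 + l) h1.
    rewrite (_ : -1 + l - 1 = -2 + l); last by lia.
    rewrite (_ : -1 + l + 1 = l); last by lia.
    by rewrite /spin /= (negbTE h2) h3.
  - rewrite shape_set_gap; set x := l - n.+1%:Z.
    have xl : l = x + n.+1%:Z by rewrite /x; lia.
    have xl1 : l - 1 = x + n%:Z by rewrite /x; lia.
    have := gap_split x n; rewrite -xl => <-.
    have mA' : measurable (A : set (OmegaLe (x + n%:Z))) by rewrite -xl1.
    have mA'' : measurable (A : set (OmegaLe (x + n.+1%:Z))).
      by apply: (measurable_OmegaLeS _ mA); lia.
    by rewrite (mu_gap mA') (mu_gap mA'') gap_massS EFinM muleCA.
  - have z B : measurable (B : set Omega) -> B `<=` shape_set l None -> mu B = 0%E.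
      move=> mB BS; apply/eqP; rewrite eq_le measure_ge0 andbT -(mu_shape_none l).
      by apply: le_measure; rewrite ?inE.
    rewrite !z ?mule0 //.
    + by apply: measurableI => //; exact: measurableI.
    + by move=> w [_ []].
case: b; last exact: false_case.
have split_mu : (mu (Tmap @^-1` A `&` shape_set l o) =
  mu (Tmap @^-1` A `&` (shape_set l o `&` [set w | Tmap_config w l = false])) +
  mu (Tmap @^-1` A `&` (shape_set l o `&` [set w | Tmap_config w l = true])))%E.
  rewrite -measureU.
  - congr (mu _); rewrite -!setIUr; congr (_ `&` _).
    by apply/seteqP; split=> w /=; [move=> h; split=> //; case: Tmap_config; [right|left]|case].
  - by do 2 apply: measurableI => //.
  - by do 2 apply: measurableI => //.
  - by apply/seteqP; split=> w //= [[_ [_ h1]] [_ [_]]]; rewrite h1.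
have m1 : measurable (Tmap @^-1` A `&` (shape_set l o `&` [set w | Tmap_config w l = true])
    : set Omega) by do 2 apply: measurableI => //.
move: split_mu; rewrite false_case.
rewrite -(fineK (fin_num_measure mu _ mTS)) -(fineK (fin_num_measure mu _ m1)).
by rewrite -!EFinM -EFinD => -[h]; congr _%:E; rewrite /weight; lra.
Qed.

(** * Consistency of the thinned measure with the kernels *)

Local Open Scope ereal_scope.

(** Partition by the distance, which fixes the weights on each piece. There, by proportionality,
    each weighted integral becomes an integral over the part where the thinned spin at [l] has the
    filled value. *)
Lemma integral_kexp1 (l : int) (h : OmegaP -> \bar R) :
  measurable_fun setT (h : OmegaLe l -> \bar R) -> (forall x, 0 <= h x) ->
  \int[mu]_w kexp (g_p p) 1 l h (Tmap w) = \int[mu]_w h (Tmap w).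
Proof.
move=> mh h0.
pose hb b : OmegaP -> \bar R := fun w => h (extend w l b).
have mhb b : measurable_fun setT (hb b : OmegaLe (l - 1)%R -> \bar R).
  exact: (measurableT_comp mh (@measurable_extend l b)).
have hb0 b x : 0 <= hb b x by exact: h0.
have w0 o b : (0 <= weight (g_p p) o b)%R by apply: weight_ge0; exact: g_p_bounds.
(* Enumerates [option nat] with [None] first, to index the partition by naturals. *)
pose idx (k : nat) : option nat := if k is k'.+1 then Some k' else None.
pose F k : set Omega := shape_set l (idx k).
have mF k : measurable (F k) by exact: measurable_shape_set.
have cover : \bigcup_k F k = setT.
  apply/seteqP; split=> // w _.
  exists (if n_of (shift l (Tmap w)) is Some k then k.+1 else 0%N) => //.
  rewrite /F (_ : idx _ = n_of (shift l (Tmap w))); first exact: past_shape_n_of.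
  by case: n_of.
have tF : trivIset setT F.
  move=> i j _ _ [w [wi wj]]; have := past_shape_inj wi wj.
  by case: i j {wi wj} => [|i] [|j] //= [->].
have mT := @measurable_Tmap.
have mhT : measurable_fun setT (fun w : Omega => h (Tmap w)).
  exact: (measurableT_comp mh (mT l)).
have mhbT b : measurable_fun setT (fun w : Omega => hb b (Tmap w)).
  exact: (measurableT_comp (mhb b) (mT _)).
have mk : measurable_fun setT (fun w : Omega => kexp (g_p p) 1 l h (Tmap w)).
  apply: (measurableT_comp _ (mT (l - 1)%R)).
  by apply: (@measurable_kexp _ _ _ _ l).
rewrite -cover !ge0_integral_bigcup ?cover //; last first.
  by move=> w _; apply: kexp_ge0 => //; exact: g_p_bounds.
apply: eq_eseriesr => k _.
pose S b : set Omega := F k `&` [set w | Tmap_config w l = b].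
have mS b : measurable (S b).
  apply: measurableI => //; apply: measurable_bool_eq.
  by apply: measurable_and; [|apply: measurable_or]; exact: measurable_Omega_spin.
have FS : F k = S false `|` S true.
  rewrite /S -setIUr; apply/esym/setIidl => w _ /=.
  by case: Tmap_config; [right|left].
transitivity (\int[mu]_(w in F k) ((weight (g_p p) (idx k) false)%:E * hb false (Tmap w) +
    (weight (g_p p) (idx k) true)%:E * hb true (Tmap w))).
  by apply: eq_integral => w /set_mem /n_ofP /= ->.
have prop b : \int[mu]_(w in S b) hb b (Tmap w) =
    (weight (g_p p) (idx k) b)%:E * \int[mu]_(w in F k) hb b (Tmap w).
  apply: (integral_proportional (mT (l - 1)%R)) => // A mA.
  exact: shape_proportion.
rewrite ge0_integralD //; first last.
- by apply: measurable_funeM; exact: measurable_funTS.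
- by move=> w _; rewrite mule_ge0 // lee_fin.
- by apply: measurable_funeM; exact: measurable_funTS.
- by move=> w _; rewrite mule_ge0 // lee_fin.
rewrite !ge0_integralZl_EFin //; try exact: measurable_funTS.
rewrite -!prop [RHS](_ : _ = \int[mu]_(w in S false `|` S true) h (Tmap w)); last by rewrite FS.
rewrite ge0_integral_setU //; first last.
- by apply/disj_setPS => w [[_ /= h1] [_ /=]]; rewrite h1.
- exact: measurable_funTS.
congr (_ + _); apply: eq_integral => w /set_mem [_ /= wl]; rewrite /hb -wl;
  by apply: (measurable_fun_agree mh); exact: agree_extend_spin.
Qed.

(** The leftmost site is integrated out with [integral_kexp1], applied to the expectation over the
    remaining sites, which only depends on spins up to [l]. *)
Lemma integral_kexp n (l m : int) (f : OmegaP -> \bar R) :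
  (l + n%:Z = m + 1)%R ->
  measurable_fun setT (f : OmegaLe m -> \bar R) -> (forall x, 0 <= f x) ->
  \int[mu]_w kexp (g_p p) n l f (Tmap w) = \int[mu]_w f (Tmap w).
Proof.
move=> + mf f0; elim: n l => [//|n IH] l lm.
have lm' : (l + 1 + n%:Z = m + 1)%R by lia.
rewrite -(IH _ lm') -[RHS](@integral_kexp1 l) //.
- by have := @measurable_kexp R (g_p p) _ _ _ _ lm' mf; rewrite addrK.
- by move=> x; apply: kexp_ge0 => //; exact: g_p_bounds.
Qed.

End ThinnedPast.

Theorem theorem3p4 (R : realType) (p : R) (hp0 : 0 < p) (hp1 : p < 1)
  (mu : probability Omega R) (hmu : is_bernoulli_product p mu) :
  exists rho : kernel_family R,
    is_LIS rho /\ LIS_translation_invariant rho /\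
    (forall w : OmegaP,
       rho 0 0 w [set w' | spin 0 w' = false] = (g_p p (n_of w))%:E /\
       rho 0 0 w [set w' | spin 0 w' = true] = (1 - g_p p (n_of w))%:E) /\
    TBF_consistent_with rho mu.
Proof.
exists (lis (g_p_bounds hp0 hp1)); split; first exact: lis_is_LIS.
split; first exact: lis_translation_invariant.
split; first by move=> w; exact: lis_spin0.
move=> l m lm f mf f0; under eq_integral do rewrite integral_lis //.
by apply: (@integral_kexp _ _ _ hp0 hp1 hmu _ l m) => //; lia.
Qed.
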